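(* Let $G$ be a finite group and let $\chi\in\mathrm{Irr}(G)$. Assume that $\chi_N$ is irreducible, where $N\vartriangleleft G$, and further that $\chi_M$ is homogeneous for all $M\vartriangleleft G$ with $M\subseteq N$. Then $\chi$ is quasiprimitive.
   Context: All groups are finite. $\mathrm{Irr}(G)$ denotes the set of irreducible complex characters of $G$, and $\chi_N$ denotes the restriction of $\chi$ to $N$. A character is homogeneous if it is a positive integer multiple of a single irreducible character. A character $\chi\in\mathrm{Irr}(G)$ is quasiprimitive if its restriction to every normal subgroup of $G$ is homogeneous. *)

(* Defs.v *)
From mathcomp Require Import all_boot all_order all_fingroup all_algebra.
From mathcomp Require Import all_solvable all_field all_character.

Set Implicit Arguments.
Unset Strict Implicit.
Unset Printing Implicit Defensive.

Import GroupScope GRing.Theory.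
Local Open Scope ring_scope.

(* Complex characters are the class functions of classfun.v and character.v,
   with values in algC: the complex characters of a finite group take algebraic
   values, and irr G is the family of all its irreducible ones. *)

Definition cf_homogeneous (gT : finGroupType) (G : {group gT})
    (phi : 'CF(G)) : Prop :=
  exists2 theta, theta \in irr G & exists2 e, (0 < e)%N & phi = theta *+ e.

Definition quasiprimitive (gT : finGroupType) (G : {group gT})
    (chi : 'CF(G)) : Prop :=
  chi \in irr G /\
  forall M : {group gT}, M <| G -> cf_homogeneous ('Res[M] chi).

(* Main.v *)
Require Import Defs.
From mathcomp Require Import all_boot all_order all_fingroup all_algebra.
From mathcomp Require Import all_solvable all_field all_character.

Set Implicit Arguments.
Unset Strict Implicit.
Unset Printing Implicit Defensive.

Import GroupScope Order.TTheory GRing.Theory Num.Theory.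
Local Open Scope ring_scope.

(* Let M <| G, let theta be an irreducible constituent of chi_M and put
   L = M :&: N, so that chi_L is a multiple of a single phi.  By Schur's lemma
   any two characters in Irr(M) over phi are proportional on each coset L m.
   Since [M, N] is contained in L, it follows that the constituents of chi_M,
   which are all N-conjugate because chi_N is irreducible, have the same
   stabiliser S in N; hence S <| G and chi_S = e alpha with alpha irreducible.
   Let T be the stabiliser of theta in G.  The Clifford correspondence gives
   |G : T| <= e, while Frobenius reciprocity applied to alpha and chi_N gives
   e^2 <= |N : S| <= |G : T|.  So T = G and chi_M is a multiple of theta. *)

(** The row space of [D2] is a nonzero submodule, hence everything, so [D2] is invertible. Then
    [invmx D2 *m D1] centralises [rG] and is scalar by Schur's lemma. In the application [s] is [rG]
    twisted by a conjugation. *)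
Lemma mx_abs_irr_semilinear_scale (F : fieldType) (gT : finGroupType)
    (G : {group gT}) n (rG : mx_representation F G n) (s : gT -> 'M[F]_n)
    (D1 D2 : 'M_n) :
    mx_absolutely_irreducible rG -> D2 != 0 ->
    {in G, forall x, s x *m D1 = D1 *m rG x} ->
    {in G, forall x, s x *m D2 = D2 *m rG x} ->
  exists c, D1 = c *: D2.
Proof.
move=> irrG nzD2 sD1 sD2.
have uD2: D2 \in unitmx.
  have /mx_irrP[_ full] := mx_abs_irrW irrG.
  rewrite -row_full_unit full //; apply/mxmoduleP=> x Gx.
  by rewrite -sD2 // submxMl.
suffices /(mx_abs_irr_cent_scalar irrG)/is_scalar_mxP[c Dc]:
    centgmx rG (invmx D2 *m D1).
  by exists c; rewrite -mul_mx_scalar -Dc mulKVmx.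
apply/centgmxP=> x Gx; rewrite -mulmxA -sD1 // -[in RHS](mulKmx uD2 (rG x)).
by rewrite -sD2 // !mulmxA mulmxK.
Qed.

(** * Proportionality of irreducible characters on cosets of a normal subgroup *)

Section Proportional.

Variables (gT : finGroupType) (M L : {group gT}).
Hypothesis nLM : L <| M.

(* The sum of theta(z^-1) z over L acts as a scalar, by Schur's lemma. *)
Lemma sum_normal_irr (i : Iirr M) :
  exists2 c, c != 0 &
    {in M, forall g : gT, \sum_(z in L) 'chi_i z^-1%g * 'chi_i (z * g)%g
                       = c * 'chi_i g}.
Proof.
have sLM := normal_sub nLM.
pose A := \sum_(z in L) 'chi_i z^-1%g *: 'Chi_i z.
have /is_scalar_mxP[c Dc]: is_scalar_mx A.
  apply: (@mx_abs_irr_cent_scalar _ _ _ _ 'Chi_i).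
    exact/groupC/socle_irr.
  apply/centgmxP=> x Mx; rewrite mulmx_suml mulmx_sumr.
  (* Conjugation by [x] permutes [L] and preserves the coefficients, so [A] commutes with the
     representation. *)
  rewrite [RHS](reindex_inj (conjg_inj x)) /=; apply: eq_big => [z | z Lz].
    by rewrite memJ_norm // (subsetP (normal_norm nLM)).
  have Mz := subsetP sLM z Lz.
  rewrite -scalemxAl -scalemxAr -conjVg cfunJ // -!repr_mxM ?groupJ //.
  by rewrite -conjgC.
have trA g : g \in M ->
    \sum_(z in L) 'chi_i z^-1%g * 'chi_i (z * g)%g = c * 'chi_i g.
  move=> Mg; rewrite -[in RHS]irrRepr cfunE Mg mulr1n -mxtraceZ -mul_scalar_mx.
  rewrite -Dc mulmx_suml raddf_sum; apply: eq_bigr => z Lz /=.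
  have Mz := subsetP sLM z Lz.
  rewrite -[in X in _ * X = _]irrRepr cfunE groupM // mulr1n.
  by rewrite -scalemxAl mxtraceZ repr_mxM.
exists c => //; apply/eqP=> c0.
(* At [g = 1] the sum consists of squared absolute values, and its term at [z = 1] is positive. *)
have /eqP := trA 1%g (group1 M); rewrite c0 mul0r psumr_eq0 => [|z Lz].
  move/allP/(_ 1%g); rewrite mem_index_enum group1 invg1 mulg1 => /(_ isT).
  by rewrite /= mulf_eq0 orbb (negPf (irr1_neq0 i)).
by rewrite mulg1 char_inv ?irr_char // mulrC mul_conjC_ge0.
Qed.

(** On the coset [L m] each character is a multiple of [\tr ('Chi_j z *m D)], where [D] intertwines
    ['Chi_j] with its conjugate by [m]; such a [D] is unique up to a scalar. The cross-multiplied
    form allows for zero values. *)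
Lemma irr_lcoset_proportional (j : Iirr L) (i1 i2 : Iirr M) e1 e2 m x :
    'Res[L] 'chi_i1 = e1 *: 'chi_j -> 'Res[L] 'chi_i2 = e2 *: 'chi_j ->
    m \in M -> x \in L ->
  'chi_i1 (x * m)%g * 'chi_i2 m = 'chi_i1 m * 'chi_i2 (x * m)%g.
Proof.
move=> Res1 Res2 Mm Lx; have sLM := normal_sub nLM.
have nLm: m \in 'N(L) by rewrite (subsetP (normal_norm nLM)).
pose D (i : Iirr M) := \sum_(y in L) 'chi_i (y * m)%g *: 'Chi_j y^-1%g.
(* Substitute [y] for the product of the summation variable and [z] in [sum_normal_irr] at [z * m]:
   the first factor becomes ['chi_i (z * y^-1)], which is [e] times the trace of
   ['Chi_j z *m 'Chi_j y^-1]. *)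
have DE i e : 'Res[L] 'chi_i = e *: 'chi_j ->
    exists c, {in L, forall z : gT, 'chi_i (z * m)%g = c * \tr ('Chi_j z *m D i)}.
  move=> Resi; have [c nzc Dc] := sum_normal_irr i.
  exists (c^-1 * e) => z Lz; apply: (mulfI nzc).
  rewrite -Dc ?(groupM (subsetP sLM z Lz) Mm) // -!mulrA mulVKf //.
  rewrite mulmx_sumr raddf_sum mulr_sumr.
  rewrite (reindex_inj (mulIg z^-1%g)) /=; apply: eq_big => [y | y].
    by rewrite groupMr ?groupV.
  rewrite groupMr ?groupV // => Ly.
  rewrite mulgA mulgKV mulrC -scalemxAr mxtraceZ mulrCA; congr (_ * _).
  have Lzy: (z * y^-1)%g \in L by rewrite groupM ?groupV.
  rewrite invMg invgK -(cfResE _ sLM) // Resi cfunE; congr (_ * _).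
  by rewrite -[in LHS]irrRepr cfunE Lzy mulr1n repr_mxM ?groupV.
(* After reindexing, the coefficients agree because [y * m * l] and [l * y * m] are conjugate under
   [l]. *)
have DJ i : {in L, forall l : gT, 'Chi_j (l ^ m^-1)%g *m D i = D i *m 'Chi_j l}.
  move=> l Ll; rewrite mulmx_suml mulmx_sumr.
  have Llm: (l ^ m^-1)%g \in L by rewrite memJ_norm ?groupV.
  rewrite (reindex_inj (mulIg (l ^ m^-1)%g)) /=.
  rewrite [RHS](reindex_inj (mulgI l)) /=.
  apply: eq_big => [y | y]; first by rewrite groupMr // groupMl.
  rewrite groupMr // => Ly; rewrite -!scalemxAl -!scalemxAr.
  rewrite -!repr_mxM ?groupV ?(groupM Ly Llm) ?(groupM Ll Ly) //.
  have -> : (l ^ m^-1 * (y * l ^ m^-1)^-1)%g = y^-1%g.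
    by rewrite (invMg y) mulKVg.
  have -> : ((l * y)^-1 * l)%g = y^-1%g by rewrite (invMg l) mulgKV.
  congr (_ *: _); rewrite -[in RHS](cfunJ _ _ (subsetP sLM l Ll)); congr ('chi_i _).
  by rewrite !conjgE !invgK -!mulgA !(mulKVg, mulVg, mulg1, mulKg).
have [c1 E1] := DE _ _ Res1; have [c2 E2] := DE _ _ Res2.
have [] := (E1 1%g (group1 L), E2 1%g (group1 L)); rewrite mul1g => E1m E2m.
rewrite E1 // E2 // E1m E2m.
have [-> | nzD2] := eqVneq (D i2) 0; first by rewrite !mulmx0 !mxtrace0 !mulr0.
have irrj: mx_absolutely_irreducible 'Chi_j by exact/groupC/socle_irr.
have [c ->] := mx_abs_irr_semilinear_scale irrj nzD2 (DJ i1) (DJ i2).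
rewrite -!scalemxAr !mxtraceZ mulrACA [RHS]mulrACA; congr (_ * _).
by rewrite mulrAC.
Qed.

End Proportional.

(** Both [m ^ s] and [m] lie in one coset of [L], so proportionality carries the equality of values
    at these points from ['chi_i1] to ['chi_i2], provided ['chi_i1 m] is nonzero. *)
Lemma irr_normal_same_inertia (gT : finGroupType) (M L : {group gT})
    (j : Iirr L) (i1 i2 : Iirr M) e1 e2 n s :
    L <| M -> 'Res[L] 'chi_i1 = e1 *: 'chi_j ->
    'Res[L] 'chi_i2 = e2 *: 'chi_j ->
    n \in 'N(M) -> {in M, forall m : gT, (m ^ n * m^-1)%g \in L} ->
    s \in 'N(M) -> {in M, forall m : gT, (m ^ s * m^-1)%g \in L} ->
    'chi_i2 = ('chi_i1 ^ n)%CF -> s \in 'I['chi_i1] ->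
  s \in 'I['chi_i2].
Proof.
move=> nLM Res1 Res2 nMn Ln nMs Ls D2 Is.
have prop := irr_lcoset_proportional nLM Res1 Res2.
(* Proportionality at [m] and [m ^ n^-1] gives ['chi_i2 m] squared on one side, since
   ['chi_i1 (m ^ n^-1)] equals ['chi_i2 m]. *)
have van m : m \in M -> 'chi_i1 m = 0 -> 'chi_i2 m = 0.
  move=> Mm m0; have Mm' : (m ^ n^-1)%g \in M by rewrite memJ_norm ?groupV.
  have := prop _ _ Mm' (Ln _ Mm').
  rewrite mulgKV conjgKV m0 mul0r -(cfConjgE 'chi_i1 m nMn) -D2 => /esym/eqP.
  by rewrite mulf_eq0 orbb => /eqP.
have valJ m : m \in M -> 'chi_i2 (m ^ s)%g = 'chi_i2 m.
  move=> Mm; have Mms : (m ^ s)%g \in M by rewrite memJ_norm.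
  have [m0 | nz] := eqVneq ('chi_i1 m) 0.
    by rewrite !van // (inertia_valJ m Is).
  have := prop _ _ Mm (Ls _ Mm).
  by rewrite mulgKV (inertia_valJ m Is) => /(mulfI nz).
rewrite inE nMs; apply/eqP/cfun_inP=> x Mx; rewrite cfConjgE //.
by rewrite -valJ ?conjgKV // memJ_norm ?groupV.
Qed.

(** * Degree and index bounds that force a constituent to be invariant *)

Lemma cfdot_irr_mul1_le (gT : finGroupType) (G : {group gT}) (phi : 'CF(G))
    (i : Iirr G) :
  phi \is a character -> '[phi, 'chi_i] * 'chi_i 1%g <= phi 1%g.
Proof.
move=> Nphi; rewrite [in leRHS](cfun_sum_cfdot phi) sum_cfunE (bigD1 i) //=.
rewrite cfunE lerDl sumr_ge0 // => j _; rewrite cfunE mulr_ge0 //.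
  by rewrite natr_ge0 ?Cnat_cfdot_char_irr.
by rewrite ltW ?irr1_gt0.
Qed.

Lemma homogeneous_inertia_invariant (gT : finGroupType) (G M N : {group gT})
    (i : Iirr G) (t : Iirr M) :
    M <| G -> N \subset G -> t \in irr_constt ('Res[M] 'chi_i) ->
    'Res[N] 'chi_i \in irr N ->
    cf_homogeneous ('Res[N :&: 'I_G['chi_t]] 'chi_i) ->
  G \subset 'I['chi_t].
Proof.
move=> nMG sNG chi_t irrN [_ /irrP[a ->] [e e_gt0 chiS]].
pose T := 'I_G['chi_t]%G; pose S := (N :&: T)%G; pose n := #|G : T|.
have sTG : T \subset G := Inertia_sub G 'chi_t.
have sSN : S \subset N := subsetIl _ _.
have sST : S \subset T := subsetIr _ _.
have sSG := subset_trans sST sTG.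
have [s s_t Di] : exists2 s, s \in irr_constt ('Ind[T] 'chi_t)
                           & 'chi_i = 'Ind[G] 'chi_s.
  have [irrInd _ im _ _] := constt_Inertia_bijection t nMG.
  have : i \in irr_constt ('Ind[G] 'chi_t) by rewrite constt_Ind_Res.
  by rewrite -im => /imsetP[s As ->]; exists s; rewrite // cfIirrE ?irrInd.
have chi1 : 'chi_i 1%g = e%:R * 'chi_a 1%g.
  by rewrite -(cfRes1 S) chiS -scaler_nat cfunE.
(* Every constituent of ['chi_s] on [S] lies in [chi_S], hence is ['chi_a]. So ['chi_s] has degree
   at least that of ['chi_a], while [n] times the former is [e] times the latter. *)
have le_ne : (n <= e)%N.
  rewrite -(ler_nat algC) -(ler_pM2r (irr1_gt0 a)) -chi1 Di cfInd1 //.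
  rewrite ler_pM2l ?ltr0n ?indexg_gt0 // -(cfRes1 S 'chi_s).
  have NsS : 'Res[S] 'chi_s \is a character by rewrite cfRes_char ?irr_char.
  have [b s_b] : exists b, b \in irr_constt ('Res[S] 'chi_s).
    by apply/neq0_has_constt; rewrite Res_irr_neq0.
  suffices <- : b = a by apply: char1_ge_constt.
  have chi_s : s \in irr_constt ('Res[T] 'chi_i).
    by rewrite -constt_Ind_Res -Di constt_irr inE.
  have := constt_Res_trans (cfRes_char _ (irr_char i)) chi_s s_b.
  rewrite cfResRes // chiS irr_consttE cfdotMnl cfdot_irr.
  by have [-> // | _] := eqVneq a b; rewrite mul0rn eqxx.
have le_een : (e * e <= n)%N.
  apply: leq_trans (_ : #|N : S| <= n)%N; last first.
    by rewrite indexgI subset_leq_card ?imsetS.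
  (* By reciprocity [chi_N] occurs [e] times in ['Ind[N] 'chi_a]; compare degrees. *)
  rewrite -(ler_nat algC) -(ler_pM2r (irr1_gt0 a)) -cfInd1 // natrM -mulrA.
  rewrite -chi1 -(cfRes1 N 'chi_i); have /irrP[k Dk] := irrN; rewrite Dk.
  suffices <- : '['Ind[N] 'chi_a, 'chi_k] = e%:R.
    by apply: cfdot_irr_mul1_le; rewrite cfInd_char ?irr_char.
  rewrite -Frobenius_reciprocity -Dk cfResRes // chiS cfdotMnr cfdot_irr.
  by rewrite eqxx.
have : n == 1%N.
  rewrite eqn_leq indexg_gt0 andbT (leq_trans le_ne) //.
  by rewrite -(leq_pmul2l e_gt0) muln1 (leq_trans le_een).
by rewrite indexg_eq1 subsetI => /andP[].
Qed.

(** By Clifford's theorem the restriction is a multiple of the sum over the [G]-class of ['chi_t],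
    which here is a single character. *)
Lemma invariant_cf_homogeneous (gT : finGroupType) (G M : {group gT})
    (i : Iirr G) (t : Iirr M) :
    M <| G -> t \in irr_constt ('Res[M] 'chi_i) -> G \subset 'I['chi_t] ->
  cf_homogeneous ('Res[M] 'chi_i).
Proof.
move=> nMG chi_t inv; exists 'chi_t; first exact: mem_irr.
have /natrP[e De] : '['Res[M] 'chi_i, 'chi_t] \in Num.nat.
  by rewrite Cnat_cfdot_char_irr ?cfRes_char ?irr_char.
exists e; first by move: chi_t; rewrite irr_consttE De pnatr_eq0 lt0n.
rewrite {1}(Clifford_Res_sum_cfclass nMG chi_t) cfclass_invariant // big_seq1.
by rewrite De scaler_nat.
Qed.

Lemma constt_Res_cfclass (gT : finGroupType) (G M : {group gT})
    (i : Iirr G) (t k : Iirr M) :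
    M <| G -> t \in irr_constt ('Res[M] 'chi_i) ->
    k \in irr_constt ('Res[M] 'chi_i) ->
  'chi_k \in ('chi_t ^: G)%CF.
Proof.
move=> nMG chi_t; rewrite irr_consttE (Clifford_Res_sum_cfclass nMG chi_t).
apply: contraNT => notGk; rewrite cfdotZl cfdot_suml big_seq big1 ?mulr0 //.
move=> psi Gpsi; have /cfclassP[y _ Dpsi] := Gpsi.
rewrite Dpsi -conjg_IirrE cfdot_irr; case: eqP => // Dk.
by rewrite -Dk conjg_IirrE -Dpsi Gpsi in notGk.
Qed.

Theorem corollaryB (gT : finGroupType) (G N : {group gT}) (chi : 'CF(G))
    (chi_irr : chi \in irr G) (nNG : N <| G)
    (chiN_irr : 'Res[N] chi \in irr N)
    (chiM_hom : forall M : {group gT},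
       M <| G -> M \subset N -> cf_homogeneous ('Res[M] chi)) :
  quasiprimitive chi.
Proof.
split=> // M nMG; have /irrP[i Di] := chi_irr.
rewrite {chi chi_irr}Di in chiN_irr chiM_hom *.
have [sMG sNG] := (normal_sub nMG, normal_sub nNG).
have [nGM nGN] := (subsetP (normal_norm nMG), subsetP (normal_norm nNG)).
have [t chi_t] : exists t, t \in irr_constt ('Res[M] 'chi_i).
  by apply/neq0_has_constt; rewrite Res_irr_neq0.
pose L := (M :&: N)%G.
have nLG : L <| G by rewrite normalI.
have sLM : L \subset M := subsetIl _ _.
have nLM : L <| M := normalS sLM sMG nLG.
have [_ /irrP[j ->] [e e_gt0 chiL]] := chiM_hom L nLG (subsetIr _ _).
(* A constituent of ['Res[L] 'chi_k] is one of [chi_L], so it is ['chi_j]. *)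
have ResL k : k \in irr_constt ('Res[M] 'chi_i) ->
    exists c, 'Res[L] 'chi_k = c *: 'chi_j.
  move=> chi_k; exists '['Res[L] 'chi_k, 'chi_j].
  rewrite {1}['Res[L] 'chi_k]cfun_sum_cfdot (bigD1 j) //= big1 ?addr0 // => b.
  move=> ne_bj; apply/eqP; rewrite scaler_eq0; apply/orP; left.
  apply: contraNT ne_bj => nz_b.
  have := constt_Res_trans (cfRes_char _ (irr_char i)) chi_k nz_b.
  rewrite cfResRes // chiL irr_consttE cfdotMnl cfdot_irr.
  by have [// | _] := eqVneq j b; rewrite mul0rn eqxx.
have commL n : n \in N -> {in M, forall m : gT, (m ^ n * m^-1)%g \in L}.
  move=> Nn m Mm.
  have Mmn : (m ^ n)%g \in M by rewrite memJ_norm ?nGM ?(subsetP sNG).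
  rewrite inE groupM ?groupV //=.
  (* The same commutator, regrouped as a product of elements of [N]. *)
  have -> : (m ^ n * m^-1)%g = (n^-1 * n ^ m^-1)%g.
    by rewrite !conjgE invgK !mulgA.
  by rewrite groupM ?groupV // memJ_norm // groupV nGN ?(subsetP sMG).
(* As chi_N is irreducible, so is chi_MN, and M fixes each of its characters. *)
have conjN k : k \in irr_constt ('Res[M] 'chi_i) ->
    exists2 n, n \in N & 'chi_k = ('chi_t ^ n)%CF.
  pose K := (M <*> N)%G.
  have sMK : M \subset K := joing_subl _ _.
  have sNK : N \subset K := joing_subr _ _.
  have sKG : K \subset G by rewrite join_subG sMG.
  have nMK : M <| K := normalS sMK sKG nMG.
  have /irrP[r Dr] : 'Res[K] 'chi_i \in irr K.
    by apply: (@cfRes_irr_irr _ _ N); rewrite ?cfRes_char ?irr_char ?cfResRes.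
  rewrite -(cfResRes _ sMK sKG) Dr in chi_t *.
  move=> /(constt_Res_cfclass nMK chi_t)/cfclassP[y].
  rewrite /= norm_joinEr ?(subset_trans sNG) ?normal_norm //.
  case/mulsgP=> m n Mm Nn -> ->; exists n => //.
  rewrite (cfConjgM 'chi_t nMG) ?(cfConjg_id _ Mm) //.
    exact: (subsetP sMG).
  exact: (subsetP sNG).
have inertN k : k \in irr_constt ('Res[M] 'chi_i) ->
    N :&: 'I['chi_k] = N :&: 'I['chi_t].
  move=> chi_k; have [n Nn Dk] := conjN k chi_k.
  have [[c1 Rt] [c2 Rk]] := (ResL t chi_t, ResL k chi_k).
  (* The relation is symmetric through [n^-1], so one lemma gives both inclusions. *)
  have Dt : 'chi_t = ('chi_k ^ n^-1)%CF by rewrite Dk cfConjgK.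
  have Nn' : n^-1%g \in N by rewrite groupV.
  have nMN y : y \in N -> y \in 'N(M) by move=> Ny; apply/nGM/(subsetP sNG).
  apply/setP=> s; rewrite in_setI [RHS]in_setI; apply: andb_id2l => Ns.
  apply/idP/idP; last exact: irr_normal_same_inertia nLM Rt Rk (nMN n Nn)
    (commL n Nn) (nMN s Ns) (commL s Ns) Dk.
  exact: irr_normal_same_inertia nLM Rk Rt (nMN _ Nn') (commL _ Nn')
    (nMN s Ns) (commL s Ns) Dt.
apply: (invariant_cf_homogeneous nMG chi_t).
apply: (homogeneous_inertia_invariant nMG sNG chi_t chiN_irr).
(* Conjugation by [g] yields the stabiliser in [N] of the conjugate of ['chi_t], again a constituent
   of [chi_M], so [inertN] applies. *)
have nSG : N :&: 'I_G['chi_t] <| G.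
  rewrite setIA (setIidPl sNG) /normal subIset ?sNG //=.
  apply/subsetP=> g Gg.
  rewrite inE conjIg (normP (nGN g Gg)) conjg_inertia ?nGM // -conjg_IirrE inertN //.
  by rewrite irr_consttE conjg_IirrE cfdot_Res_conjg // -irr_consttE.
exact: (chiM_hom (N :&: 'I_G['chi_t])%G nSG (subsetIl _ _)).
Qed.
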